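(* Let $n$ be a positive integer, let $P=\{(x_i,u_i)\in\mathbf{R}\times\mathbf{R}_F: i=0,1,\dots,n\}$ with $x_0<x_1<\cdots<x_n$, and put $I=[x_0,x_n]$, $I_i=[x_{i-1},x_i]$ for $i=1,\dots,n$. For $i=1,\dots,n$ let $l_i:I\to I_i$ be a homeomorphism with $l_i(x_0)=x_{i-1}$, $l_i(x_n)=x_i$ which is a similitude, i.e. there is $c_{l_i}\in[0,1)$ with $|l_i(x)-l_i(y)|=c_{l_i}|x-y|$ for all $x,y\in I$; let $s_i$ be a constant with $0\le s_i<1$; and let $q_i:I_i\to\mathbf{R}_F$ be a Lipschitz mapping (with respect to $d_\infty$ on $\mathbf{R}_F$) such that the mapping $F_i:I\times\mathbf{R}_F\to\mathbf{R}_F$, $F_i(x,u)=s_iu\oplus q_i(l_i(x))$, satisfies $F_i(x_0,u_0)=u_{i-1}$ and $F_i(x_n,u_n)=u_i$. Then the fuzzy-valued fractal interpolation function $f:I\to\mathbf{R}_F$ interpolating $P$ determined by these data is Hölder continuous, that is, there exist a constant $H_f$ and a constant $0<\tau\le1$ such that $d_\infty(f(x),f(x'))\le H_f|x-x'|^\tau$ for all $x,x'\in I$.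
   Context: A fuzzy number is a function $u:\mathbf{R}\to[0,1]$ that is normal ($u(y)=1$ for some $y$), upper semicontinuous, convex ($u(ty+(1-t)z)\ge\min\{u(y),u(z)\}$ for all $y,z\in\mathbf{R}$, $t\in[0,1]$) and compactly supported (the closure of $\{y:u(y)>0\}$ is compact). $\mathbf{R}_F$ is the set of fuzzy numbers. For $u\in\mathbf{R}_F$, the $\lambda$-level set is $[u]^\lambda=\{y:u(y)\ge\lambda\}$ for $\lambda\in(0,1]$ and $[u]^0=\overline{\{y:u(y)>0\}}$; it is a closed interval, written $[u^-(\lambda),u^+(\lambda)]$. The operations are defined by level sets: $[u\oplus v]^\lambda=[u]^\lambda+[v]^\lambda$ and $[cu]^\lambda=c[u]^\lambda$ for $c\in\mathbf{R}$ (Minkowski sum and scaling of intervals). The metric on $\mathbf{R}_F$ is $d_\infty(u,v)=\sup_{\lambda\in[0,1]}\max\{|u^-(\lambda)-v^-(\lambda)|,|u^+(\lambda)-v^+(\lambda)|\}$; $(\mathbf{R}_F,d_\infty)$ is a complete metric space. The fuzzy-valued fractal interpolation function $f$ interpolating $P$ is the continuous function $f:I\to(\mathbf{R}_F,d_\infty)$ with $f(x_i)=u_i$ $(i=0,\dots,n)$ whose graph is the attractor (unique nonempty compact set $B$ with $B=\bigcup_{i=1}^n w_i(B)$) of the iterated function system $w_i(x,u)=(l_i(x),F_i(x,u))$ on $I\times\mathbf{R}_F$; equivalently, it is the unique continuous function with $f(x_i)=u_i$ for all $i$ and $f(x)=s_if(l_i^{-1}(x))\oplus q_i(x)$ for $x\in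 I_i$, $i=1,\dots,n$. *)

(* Defs.v *)
From HB Require Import structures.
From mathcomp Require Import all_boot all_order all_algebra.
From mathcomp Require Import all_classical all_reals all_analysis.
From mathcomp Require Import ring lra.
Set Implicit Arguments.
Unset Strict Implicit.
Unset Printing Implicit Defensive.
Import Order.TTheory GRing.Theory Num.Theory.
Import numFieldNormedType.Exports.
Local Open Scope classical_set_scope.
Local Open Scope ring_scope.

Definition upper_semicontinuous (R : realType) (u : R -> R) : Prop :=
  forall x a, u x < a -> \forall y \near x, u y < a.

Record fuzzyNumber (R : realType) : Type := FuzzyNumber {
  membership :> R -> R ;
  membership_itv01 : forall y, 0 <= membership y <= 1 ;
  membership_normal : exists y, membership y = 1 ;
  membership_usc : upper_semicontinuous membership ;
  membership_convex : forall y z t, 0 <= t <= 1 ->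
    Num.min (membership y) (membership z) <= membership (t * y + (1 - t) * z) ;
  membership_compact : compact (closure [set y | 0 < membership y]) }.

Definition level (R : realType) (u : fuzzyNumber R) (lam : R) : set R :=
  if lam == 0 then closure [set y | 0 < u y] else [set y | lam <= u y].

Definition level_lo (R : realType) (u : fuzzyNumber R) (lam : R) : R :=
  inf (level u lam).

Definition level_hi (R : realType) (u : fuzzyNumber R) (lam : R) : R :=
  sup (level u lam).

Lemma level0 (R : realType) (u : fuzzyNumber R) :
  level u 0 = closure [set y | 0 < u y].
Proof. by rewrite /level eqxx. Qed.

Lemma level_gt0 (R : realType) (u : fuzzyNumber R) lam : 0 < lam ->
  level u lam = [set y | lam <= u y].
Proof. by move=> l0; rewrite /level gt_eqF. Qed.

Lemma fuzzyNumber_ext (R : realType) (u v : fuzzyNumber R) :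
  (forall y, u y = v y) -> u = v.
Proof.
case: u => u ? ? ? ? ?; case: v => v ? ? ? ? ? /= uv.
have {}uv : u = v by apply/funext.
subst v; congr FuzzyNumber; exact: Prop_irrelevance.
Qed.

Lemma level_inj (R : realType) (u v : fuzzyNumber R) :
  (forall lam, 0 <= lam <= 1 -> level u lam = level v lam) -> u = v.
Proof.
move=> uv; apply: fuzzyNumber_ext => y.
suff h (a b : fuzzyNumber R) :
    (forall lam, 0 <= lam <= 1 -> level a lam = level b lam) -> a y <= b y.
  by apply/eqP; rewrite eq_le !h// => lam /uv.
move=> ab; have /andP[a0 a1] := membership_itv01 a y.
have /andP[b0 _] := membership_itv01 b y.
move: a0; rewrite le_eqVlt => /predU1P[<-//|a0].
suff : level b (a y) y by rewrite level_gt0.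
by rewrite -ab ?a1 ?(ltW a0)// level_gt0//=.
Qed.

Lemma level_sub (R : realType) (u : fuzzyNumber R) lam mu :
  0 <= lam -> lam <= mu -> level u mu `<=` level u lam.
Proof.
rewrite le_eqVlt => /predU1P[<-|l0 lm].
  rewrite le_eqVlt => /predU1P[<-//|m0].
  rewrite level0 level_gt0// => y /= h; apply: subset_closure => /=.
  exact: lt_le_trans h.
by rewrite !level_gt0 ?(lt_le_trans l0)// => y /=; exact: le_trans.
Qed.

Lemma level_nonempty (R : realType) (u : fuzzyNumber R) lam :
  0 <= lam <= 1 -> level u lam !=set0.
Proof.
case/andP => l0 l1; have [y y1] := membership_normal u.
by exists y; apply: (level_sub l0 l1); rewrite level_gt0//= y1.
Qed.

Lemma level_closed (R : realType) (u : fuzzyNumber R) lam :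
  0 <= lam -> closed (level u lam).
Proof.
rewrite le_eqVlt => /predU1P[<-|l0].
  by rewrite level0; exact: closed_closure.
rewrite level_gt0// -[X in closed X]setCK; apply: open_closedC.
rewrite openE => y /= /negP; rewrite -ltNge => /(membership_usc).
by apply: filterS => z; rewrite ltNge => /negP.
Qed.

Lemma level_compact (R : realType) (u : fuzzyNumber R) lam :
  0 <= lam -> compact (level u lam).
Proof.
move=> l0; apply: (subclosed_compact (level_closed l0)).
  exact: membership_compact.
by rewrite -level0; exact: level_sub.
Qed.

Lemma level_is_interval (R : realType) (u : fuzzyNumber R) lam :
  0 <= lam -> is_interval (level u lam).
Proof.
have cvx y z w : y <= w <= z -> Num.min (u y) (u z) <= u w.
  case/andP; rewrite le_eqVlt => /predU1P[->|yw wz]; first by rewrite ge_min lexx.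
  have zy : 0 < z - y by rewrite subr_gt0 (lt_le_trans yw).
  have := @membership_convex _ u y z ((z - w) / (z - y)).
  have -> : (z - w) / (z - y) * y + (1 - (z - w) / (z - y)) * z = w.
    by field; rewrite gt_eqF.
  apply; rewrite divr_ge0 ?(ltW zy) ?subr_ge0//=.
  by rewrite ler_pdivrMr// mul1r; lra.
rewrite le_eqVlt => /predU1P[<-|l0].
  rewrite level0; apply/connected_intervalP; apply: connected_closure.
  apply/connected_intervalP => y z /= y0 z0 w /cvx; apply: lt_le_trans.
  by rewrite lt_min y0.
rewrite level_gt0// => y z /= y0 z0 w /cvx; apply: le_trans.
by rewrite le_min y0.
Qed.

Lemma level_bounded (R : realType) (u : fuzzyNumber R) :
  exists2 M, 0 <= M & forall lam y, 0 <= lam -> level u lam y -> `|y| <= M.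
Proof.
have := compact_bounded (@level_compact _ u 0 (lexx 0)).
case=> M [_ hM]; exists (Num.max 0 (M + 1)); first by rewrite le_max lexx.
move=> lam y l0 /(level_sub (lexx 0) l0) yl.
by rewrite le_max (hM (M + 1) _ y yl) ?orbT// ltrDl.
Qed.

Lemma level_has_inf (R : realType) (u : fuzzyNumber R) lam :
  0 <= lam <= 1 -> has_inf (level u lam).
Proof.
move=> l01; split; first exact: level_nonempty.
have [M _ hM] := level_bounded u; exists (- M) => y /hM.
by case/andP: l01 => l0 _ /(_ l0); rewrite ler_norml => /andP[].
Qed.

Lemma level_has_sup (R : realType) (u : fuzzyNumber R) lam :
  0 <= lam <= 1 -> has_sup (level u lam).
Proof.
move=> l01; split; first exact: level_nonempty.
have [M _ hM] := level_bounded u; exists M => y /hM.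
by case/andP: l01 => l0 _ /(_ l0); rewrite ler_norml => /andP[].
Qed.

Lemma level_lo_le (R : realType) (u : fuzzyNumber R) lam y :
  0 <= lam <= 1 -> level u lam y -> level_lo u lam <= y.
Proof. by move=> /(level_has_inf u)[_ h]; exact: ge_inf. Qed.

Lemma level_hi_ge (R : realType) (u : fuzzyNumber R) lam y :
  0 <= lam <= 1 -> level u lam y -> y <= level_hi u lam.
Proof. by move=> /(level_has_sup u)[_ h]; exact: ub_le_sup. Qed.

Lemma level_lo_mem (R : realType) (u : fuzzyNumber R) lam :
  0 <= lam <= 1 -> level u lam (level_lo u lam).
Proof.
move=> l01; have /andP[l0 _] := l01.
apply: (level_closed l0) => B /nbhs_ballP[e /= e0 eB].
have [y yl ylt] := inf_adherent e0 (level_has_inf u l01).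
exists y; split=> //; apply: eB; rewrite /ball/= distrC ger0_norm.
  by rewrite ltrBlDl.
by rewrite subr_ge0; exact: level_lo_le.
Qed.

Lemma level_hi_mem (R : realType) (u : fuzzyNumber R) lam :
  0 <= lam <= 1 -> level u lam (level_hi u lam).
Proof.
move=> l01; have /andP[l0 _] := l01.
apply: (level_closed l0) => B /nbhs_ballP[e /= e0 eB].
have [y yl ylt] := sup_adherent e0 (level_has_sup u l01).
exists y; split=> //; apply: eB; rewrite /ball/= ger0_norm.
  by rewrite ltrBlDr -ltrBlDl.
by rewrite subr_ge0; exact: level_hi_ge.
Qed.

Lemma levelE (R : realType) (u : fuzzyNumber R) lam :
  0 <= lam <= 1 -> level u lam = `[level_lo u lam, level_hi u lam]%classic.
Proof.
move=> l01; have /andP[l0 _] := l01; apply/seteqP; split => y /=.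
  by rewrite in_itv/= => yl; rewrite level_lo_le// level_hi_ge.
rewrite in_itv/=; apply: level_is_interval => //.
- exact: level_lo_mem.
- exact: level_hi_mem.
Qed.

(* The Goetschel-Voxman conditions on a lower endpoint function (and on the
   opposite of an upper endpoint function): nondecreasing on [0, 1],
   left-continuous on ]0, 1] and right-continuous at 0. *)
Definition endpoint_curve (R : realType) (g : R -> R) : Prop :=
  [/\ forall lam mu, 0 <= lam -> lam <= mu -> mu <= 1 -> g lam <= g mu,
      forall lam e, 0 < lam <= 1 -> 0 < e ->
        exists2 mu, 0 <= mu < lam & g lam - e < g mu
    & forall e, 0 < e -> exists2 mu, 0 < mu <= 1 & g mu < g 0 + e].

Lemma endpoint_curveD (R : realType) (g h : R -> R) :
  endpoint_curve g -> endpoint_curve h -> endpoint_curve (fun l => g l + h l).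
Proof.
move=> [gm gl gr] [hm hl hr]; split.
- by move=> lam mu l0 lm m1; rewrite lerD// (gm, hm).
- move=> lam e l01 e0; have e20 : 0 < e / 2 by rewrite divr_gt0.
  have [m /andP[m0 ml] gm'] := gl _ _ l01 e20.
  have [k /andP[k0 kl] hk] := hl _ _ l01 e20.
  have l1 : lam <= 1 by case/andP: l01.
  exists (Num.max m k); first by rewrite le_max m0/= gt_max ml.
  have mk1 : Num.max m k <= 1 by rewrite ge_max !(le_trans (ltW _) l1).
  have : g m <= g (Num.max m k) by rewrite gm// le_max lexx.
  have : h k <= h (Num.max m k) by rewrite hm// le_max lexx orbT.
  lra.
- move=> e e0; have e20 : 0 < e / 2 by rewrite divr_gt0.
  have [m /andP[m0 m1] gm'] := gr _ e20.
  have [k /andP[k0 k1] hk] := hr _ e20.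
  exists (Num.min m k); first by rewrite lt_min m0 k0 ge_min m1.
  have mk0 : 0 <= Num.min m k by rewrite le_min !ltW.
  have : g (Num.min m k) <= g m by rewrite gm// ge_min lexx.
  have : h (Num.min m k) <= h k by rewrite hm// ge_min lexx orbT.
  lra.
Qed.

Lemma endpoint_curveZ (R : realType) (c : R) (g : R -> R) : 0 <= c ->
  endpoint_curve g -> endpoint_curve (fun l => c * g l).
Proof.
rewrite le_eqVlt => /predU1P[<- _|c0 [gm gl gr]].
  split.
  - by move=> *; rewrite !mul0r.
  - move=> lam e /andP[l0 _] e0; exists 0; rewrite ?lexx//= !mul0r.
    by rewrite sub0r oppr_lt0.
  - by move=> e e0; exists 1; rewrite ?lexx ?ltr01// !mul0r add0r.
split.
- by move=> lam mu l0 lm m1; rewrite ler_pM2l// gm.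
- move=> lam e l01 e0; have ec0 : 0 < e / c by rewrite divr_gt0.
  have [m ? h] := gl _ _ l01 ec0; exists m => //.
  have : c * (g lam - e / c) < c * g m by rewrite ltr_pM2l.
  by rewrite mulrBr mulrCA divff ?gt_eqF// mulr1.
- move=> e e0; have ec0 : 0 < e / c by rewrite divr_gt0.
  have [m ? h] := gr _ ec0; exists m => //.
  have : c * g m < c * (g 0 + e / c) by rewrite ltr_pM2l.
  by rewrite mulrDr mulrCA divff ?gt_eqF// mulr1.
Qed.

Lemma endpoint_curve_lo (R : realType) (u : fuzzyNumber R) :
  endpoint_curve (level_lo u).
Proof.
split.
- move=> lam mu l0 lm m1; apply: level_lo_le.
    by rewrite l0 (le_trans lm).
  apply: (level_sub l0 lm); apply: level_lo_mem.
  by rewrite m1 (le_trans l0).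
- move=> lam e /[dup] l01 /andP[l0 l1] e0.
  have l01' : 0 <= lam <= 1 by rewrite ltW.
  set z := level_lo u lam - e.
  have uz : u z < lam.
    rewrite ltNge; apply/negP => lz.
    have := @level_lo_le _ u lam z l01'; rewrite level_gt0// => /(_ lz).
    by rewrite /z lerBrDl gerDr leNgt e0.
  have [z0 _] := andP (membership_itv01 u z).
  have [uzm ml] := midf_lt uz; set mu := (u z + lam) / 2 in uzm ml.
  have m0 : 0 < mu by exact: le_lt_trans uzm.
  have m01 : 0 <= mu <= 1 by rewrite !ltW// (lt_le_trans ml).
  exists mu; first by rewrite (ltW m0).
  rewrite ltNge; apply/negP => h.
  have : level u mu z.
    rewrite levelE//= in_itv/= h/=; apply: (@le_trans _ _ (level_lo u lam)).
      by rewrite /z gerBl ltW.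
    apply: level_hi_ge => //; apply: (level_sub (ltW m0) (ltW ml)).
    exact: level_lo_mem.
  by rewrite level_gt0//= leNgt uzm.
- move=> e e0.
  have := @level_lo_mem _ u 0; rewrite lexx ler01 level0 => /(_ isT).
  move=> /(_ (ball (level_lo u 0) e)) [|z [/= uz]].
    exact: nbhsx_ballx.
  rewrite /ball/= ltr_norml => /andP[h _].
  have /andP[_ u1] := membership_itv01 u z.
  exists (u z); first by rewrite uz.
  apply: (@le_lt_trans _ _ z); last lra.
  by apply: level_lo_le; rewrite ?(ltW uz)// level_gt0//=.
Qed.

Lemma endpoint_curve_hi (R : realType) (u : fuzzyNumber R) :
  endpoint_curve (fun l => - level_hi u l).
Proof.
split.
- move=> lam mu l0 lm m1; rewrite lerN2; apply: level_hi_ge.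
    by rewrite l0 (le_trans lm).
  apply: (level_sub l0 lm); apply: level_hi_mem.
  by rewrite m1 (le_trans l0).
- move=> lam e /[dup] l01 /andP[l0 l1] e0.
  have l01' : 0 <= lam <= 1 by rewrite ltW.
  set z := level_hi u lam + e.
  have uz : u z < lam.
    rewrite ltNge; apply/negP => lz.
    have := @level_hi_ge _ u lam z l01'; rewrite level_gt0// => /(_ lz).
    by rewrite /z gerDl leNgt e0.
  have [z0 _] := andP (membership_itv01 u z).
  have [uzm ml] := midf_lt uz; set mu := (u z + lam) / 2 in uzm ml.
  have m0 : 0 < mu by exact: le_lt_trans uzm.
  have m01 : 0 <= mu <= 1 by rewrite !ltW// (lt_le_trans ml).
  exists mu; first by rewrite (ltW m0).
  rewrite -opprD ltrN2 -/z ltNge; apply/negP => h.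
  have : level u mu z.
    rewrite levelE//= in_itv/= h andbT.
    apply: (@le_trans _ _ (level_hi u lam)); last by rewrite /z lerDl ltW.
    apply: level_lo_le => //; apply: (level_sub (ltW m0) (ltW ml)).
    exact: level_hi_mem.
  by rewrite level_gt0//= leNgt uzm.
- move=> e e0.
  have := @level_hi_mem _ u 0; rewrite lexx ler01 level0 => /(_ isT).
  move=> /(_ (ball (level_hi u 0) e)) [|z [/= uz]].
    exact: nbhsx_ballx.
  rewrite /ball/= ltr_norml => /andP[_ h].
  have /andP[_ u1] := membership_itv01 u z.
  exists (u z); first by rewrite uz.
  apply: (@le_lt_trans _ _ (- z)); last lra.
  by rewrite lerN2; apply: level_hi_ge; rewrite ?(ltW uz)// level_gt0//=.
Qed.

Lemma fuzzyNumber_of_endpoints (R : realType) (a b : R -> R) :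
  endpoint_curve a -> endpoint_curve (fun l => - b l) -> a 1 <= b 1 ->
  exists w : fuzzyNumber R,
    forall lam, 0 <= lam <= 1 -> level w lam = `[a lam, b lam]%classic.
Proof.
move=> [am al ar] [bm bl br] ab1.
have {}bm lam mu : 0 <= lam -> lam <= mu -> mu <= 1 -> b mu <= b lam.
  by move=> ? ? ?; rewrite -lerN2 bm.
pose S z := [set mu | 0 <= mu <= 1 /\ a mu <= z <= b mu].
pose w z := sup (S z).
have S1 z : ubound (S z) 1 by move=> mu [/andP[]].
have wS lam z : 0 < lam <= 1 -> (lam <= w z) <-> (a lam <= z <= b lam).
  move=> /[dup] l01 /andP[l0 l1]; split=> [lw|lz]; last first.
    apply: ub_le_sup; first by exists 1.
    by split => //; rewrite ltW.
  have lt mu : 0 <= mu < lam -> a mu <= z <= b mu.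
    case/andP => m0 ml; have Sn : S z !=set0.
      apply/set0P/eqP => S0; move: lw; rewrite /w S0 sup0.
      by rewrite leNgt l0.
    have [k [/andP[k0 k1] /andP[ak bk]] mk] :=
      sup_gt Sn (lt_le_trans ml lw).
    by rewrite (le_trans (am _ _ m0 (ltW mk) k1))// (le_trans bk)// bm// ltW.
  apply/andP; split; rewrite leNgt; apply/negP => h.
    have e0 : 0 < a lam - z by rewrite subr_gt0.
    have [mu /lt/andP[amu _]] := al _ _ l01 e0; lra.
  have e0 : 0 < z - b lam by rewrite subr_gt0.
  have [mu /lt/andP[_ bmu]] := bl _ _ l01 e0; lra.
have w1 z : w z <= 1.
  have [S0|/set0P Sn] := eqVneq (S z) set0; first by rewrite /w S0 sup0.
  by apply: ge_sup.
have w0 z : 0 <= w z.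
  have [S0|/set0P[mu Smu]] := eqVneq (S z) set0; first by rewrite /w S0 sup0.
  apply: (@le_trans _ _ mu); first by case: Smu => /andP[].
  by apply: ub_le_sup => //; exists 1.
have supp : closure [set z | 0 < w z] = `[a 0, b 0]%classic.
  apply/seteqP; split.
    rewrite [X in _ `<=` X](closure_id _).1; last exact: itv_closed.
    apply: closureS => z /= wz; rewrite in_itv/=.
    have /wS : 0 < w z <= 1 by rewrite wz w1.
    move=> /(_ z)[/(_ (lexx _))/andP[aw bw] _].
    rewrite (le_trans _ aw) ?am// ?(le_trans bw) ?bm//.
  move=> z /=; rewrite in_itv/= => /andP[az bz] B /nbhs_ballP[e /= e0 eB].
  have [m /andP[m0 m1] am'] := ar _ e0.
  have [k /andP[k0 k1] bk] := br _ e0.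
  pose mu := Num.min m k.
  have mu0 : 0 < mu by rewrite lt_min m0.
  have mu1 : mu <= 1 by rewrite ge_min m1.
  have amu : a mu <= a m by rewrite am// ?(ltW mu0)// ge_min lexx.
  have bmu : b k <= b mu by rewrite bm// ?(ltW mu0)// ge_min lexx orbT.
  have abmu : a mu <= b mu.
    by rewrite (le_trans (am _ _ (ltW mu0) mu1 _))// (le_trans ab1)// bm// ltW.
  have [y ymu yz] : exists2 y, a mu <= y <= b mu & `|z - y| < e.
    have [za|za] := leP z (a mu).
      exists (a mu); first by rewrite lexx.
      by rewrite ltr_norml; lra.
    have [zb|zb] := leP z (b mu).
      by exists z; [rewrite (ltW za)|rewrite subrr normr0].
    exists (b mu); first by rewrite abmu lexx.
    by rewrite ltr_norml; lra.
  exists y; split; last exact: eB.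
  by apply: (lt_le_trans mu0); apply/wS => //; rewrite mu0.
have wusc : upper_semicontinuous w.
  move=> z c wc; have c0 : 0 < c by exact: le_lt_trans wc.
  have [c1|c1] := ltP 1 c.
    by apply: (@nearW _ (nbhs z)) => y; exact: le_lt_trans c1.
  have : open (~` `[a c, b c]%classic) by exact/closed_openC/itv_closed.
  have Ew y : (c <= w y) <-> (y \in `[a c, b c]).
    by rewrite in_itv/=; apply: wS; rewrite c0.
  have zc : (~` `[a c, b c]%classic) z by move=> /Ew; rewrite leNgt wc.
  move=> oc; have : nbhs z (~` `[a c, b c]%classic) by exact: open_nbhs_nbhs.
  apply: (@filterS _ (nbhs z)).
  by move=> y /= yc; rewrite ltNge; apply/negP => /Ew.
have wcvx y z t : 0 <= t <= 1 -> Num.min (w y) (w z) <= w (t * y + (1 - t) * z).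
  case/andP => t0 t1; set lam := Num.min _ _.
  have [l0|l0] := leP lam 0; first exact: le_trans (w0 _).
  have l01 : 0 < lam <= 1 by rewrite l0 ge_min w1.
  apply/(wS _ _ l01).
  have /(wS _ _ l01)/andP[ay yb] : lam <= w y by rewrite ge_min lexx.
  have /(wS _ _ l01)/andP[az zb] : lam <= w z by rewrite ge_min lexx orbT.
  apply/andP; split; nra.
have wn : exists y, w y = 1.
  exists (a 1); apply/eqP; rewrite eq_le w1/=.
  by apply/wS; rewrite ?ltr01 ?lexx//= .
have wcpt : compact (closure [set z | 0 < w z]).
  by rewrite supp; exact: segment_compact.
have w01 y : 0 <= w y <= 1 by rewrite w0 w1.
exists (FuzzyNumber w01 wn wusc wcvx wcpt) => lam /andP[].
rewrite le_eqVlt => /predU1P[<- _|l0 l1]; first by rewrite level0/= supp.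
rewrite level_gt0//=; apply/seteqP; split => y /=; rewrite in_itv/=.
  by move=> /wS; apply; rewrite l0.
by move=> h; apply/wS => //; rewrite l0.
Qed.

Lemma level_lo_le_hi (R : realType) (u : fuzzyNumber R) lam :
  0 <= lam <= 1 -> level_lo u lam <= level_hi u lam.
Proof. by move=> l01; apply: level_lo_le => //; exact: level_hi_mem. Qed.

Lemma fuzzy_add_subproof (R : realType) (u v : fuzzyNumber R) :
  exists w : fuzzyNumber R, forall lam, 0 <= lam <= 1 ->
    level w lam = [set y + z | y in level u lam & z in level v lam].
Proof.
have [||w hw] := fuzzyNumber_of_endpoints
  (endpoint_curveD (endpoint_curve_lo u) (endpoint_curve_lo v))
  (_ : endpoint_curve (fun l => - (level_hi u l + level_hi v l))).
- rewrite (_ : (fun _ => _) = fun l => - level_hi u l + - level_hi v l).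
    exact: endpoint_curveD (endpoint_curve_hi u) (endpoint_curve_hi v).
  by apply/funext => l; rewrite opprD.
- by rewrite lerD// level_lo_le_hi// ler01 lexx.
exists w => lam l01; rewrite hw// !levelE//.
have ulh := level_lo_le_hi u l01; have vlh := level_lo_le_hi v l01.
apply/seteqP; split => [x /=|x [y + [z + <-]]]; rewrite /= !in_itv/=; last first.
  by move=> /andP[y1 y2] /andP[z1 z2]; rewrite !lerD.
move=> /andP[x1 x2].
pose y := Num.min (level_hi u lam) (x - level_lo v lam).
exists y.
  rewrite in_itv/= /y le_min ulh ge_min lexx/= andbT; lra.
exists (x - y); last by rewrite addrC subrK.
rewrite in_itv/= /y; have [h|h] := leP (level_hi u lam) (x - level_lo v lam).
  by apply/andP; split; lra.
by apply/andP; split; lra.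
Qed.

Lemma fuzzy_scale_subproof (R : realType) (c : R) (u : fuzzyNumber R) :
  exists w : fuzzyNumber R, forall lam, 0 <= lam <= 1 ->
    level w lam = [set c * y | y in level u lam].
Proof.
have u1 : level_lo u 1 <= level_hi u 1 by rewrite level_lo_le_hi// ler01 lexx.
have [c0|c0] := leP 0 c.
  have [||w hw] := fuzzyNumber_of_endpoints
    (endpoint_curveZ c0 (endpoint_curve_lo u))
    (_ : endpoint_curve (fun l => - (c * level_hi u l))).
  - rewrite (_ : (fun _ => _) = fun l => c * - level_hi u l).
      exact: endpoint_curveZ (endpoint_curve_hi u).
    by apply/funext => l; rewrite mulrN.
  - exact: ler_wpM2l.
  exists w => lam l01; rewrite hw// !levelE//.
  have ulh := level_lo_le_hi u l01.
  apply/seteqP; split => [x /=|x [y + <-]]; rewrite /= !in_itv/=; last first.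
    by move=> /andP[y1 y2]; rewrite !ler_wpM2l.
  have [c00|cn0] := eqVneq c 0.
    rewrite c00 !mul0r -eq_le => /eqP <-; exists (level_lo u lam).
      by rewrite in_itv/= lexx.
    by rewrite mul0r.
  have {cn0}c0 : 0 < c by rewrite lt_neqAle eq_sym cn0.
  move=> /andP[x1 x2]; exists (x / c); last by rewrite mulrC divfK// gt_eqF.
  by rewrite in_itv/= ler_pdivlMr// ler_pdivrMr// mulrC x1 mulrC x2.
have [|||w hw] := fuzzyNumber_of_endpoints
  (_ : endpoint_curve (fun l => c * level_hi u l))
  (_ : endpoint_curve (fun l => - (c * level_lo u l))).
- rewrite (_ : (fun _ => _) = fun l => - c * - level_hi u l).
    by apply: endpoint_curveZ (endpoint_curve_hi u); rewrite oppr_ge0 ltW.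
  by apply/funext => l; rewrite mulrNN.
- rewrite (_ : (fun _ => _) = fun l => - c * level_lo u l).
    by apply: endpoint_curveZ (endpoint_curve_lo u); rewrite oppr_ge0 ltW.
  by apply/funext => l; rewrite mulNr.
- by rewrite ler_nM2l.
exists w => lam l01; rewrite hw// !levelE//.
apply/seteqP; split => [x /=|x [y + <-]]; rewrite /= !in_itv/=; last first.
  by move=> /andP[y1 y2]; rewrite !ler_nM2l// y1 y2.
move=> /andP[x1 x2]; exists (x / c); last by rewrite mulrC divfK// lt_eqF.
by rewrite in_itv/= ler_ndivlMr// ler_ndivrMr// mulrC x2 mulrC x1.
Qed.

(* The level sets determine the fuzzy number by [level_inj]. *)
Definition fuzzy_add (R : realType) (u v : fuzzyNumber R) : fuzzyNumber R :=
  projT1 (cid (fuzzy_add_subproof u v)).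

Definition fuzzy_scale (R : realType) (c : R) (u : fuzzyNumber R) :
  fuzzyNumber R := projT1 (cid (fuzzy_scale_subproof c u)).

Lemma level_add (R : realType) (u v : fuzzyNumber R) lam : 0 <= lam <= 1 ->
  level (fuzzy_add u v) lam = [set y + z | y in level u lam & z in level v lam].
Proof. exact: (projT2 (cid (fuzzy_add_subproof u v))). Qed.

Lemma level_scale (R : realType) (c : R) (u : fuzzyNumber R) lam :
  0 <= lam <= 1 -> level (fuzzy_scale c u) lam = [set c * y | y in level u lam].
Proof. exact: (projT2 (cid (fuzzy_scale_subproof c u))). Qed.

Definition fuzzy_dist (R : realType) (u v : fuzzyNumber R) : R :=
  sup [set Num.max `|level_lo u lam - level_lo v lam|
                   `|level_hi u lam - level_hi v lam| | lam in `[0, 1]].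

Lemma fuzzy_dist_has_sup (R : realType) (u v : fuzzyNumber R) :
  has_sup [set Num.max `|level_lo u lam - level_lo v lam|
                       `|level_hi u lam - level_hi v lam| | lam in `[0, 1]].
Proof.
split.
  by eexists; exists 0 => //=; rewrite in_itv/= lexx ler01.
have [M M0 hM] := level_bounded u; have [N N0 hN] := level_bounded v.
exists (M + N) => _ [lam l01 <-]; move: l01; rewrite /= in_itv/= => l01.
have [l0 _] := andP l01.
rewrite ge_max; apply/andP; split; apply: (le_trans (ler_normB _ _)).
  by apply: lerD; [apply: hM l0 _|apply: hN l0 _]; exact: level_lo_mem.
by apply: lerD; [apply: hM l0 _|apply: hN l0 _]; exact: level_hi_mem.
Qed.

Lemma fuzzy_dist_ub (R : realType) (u v : fuzzyNumber R) lam :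
  0 <= lam <= 1 -> `|level_lo u lam - level_lo v lam| <= fuzzy_dist u v /\
                   `|level_hi u lam - level_hi v lam| <= fuzzy_dist u v.
Proof.
move=> l01; apply/andP; rewrite -ge_max.
apply: ub_le_sup; first by case: (fuzzy_dist_has_sup u v).
by exists lam => //=; rewrite in_itv.
Qed.

Lemma fuzzy_dist_le (R : realType) (u v : fuzzyNumber R) M :
  (forall lam, 0 <= lam <= 1 -> `|level_lo u lam - level_lo v lam| <= M /\
                                `|level_hi u lam - level_hi v lam| <= M) ->
  fuzzy_dist u v <= M.
Proof.
move=> h; apply: ge_sup; first by case: (fuzzy_dist_has_sup u v).
move=> _ [lam /= l01 <-]; rewrite in_itv/= in l01.
by have /andP := h _ l01; rewrite ge_max.
Qed.

Lemma fuzzy_distxx (R : realType) (u : fuzzyNumber R) : fuzzy_dist u u = 0.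
Proof.
apply/eqP; rewrite eq_le; apply/andP; split.
  by apply: fuzzy_dist_le => lam _; rewrite !subrr normr0.
have := @fuzzy_dist_ub _ u u 0; rewrite lexx ler01 => /(_ isT)[+ _].
exact: le_trans.
Qed.

Lemma fuzzy_dist_eq0 (R : realType) (u v : fuzzyNumber R) :
  fuzzy_dist u v = 0 -> u = v.
Proof.
move=> uv0; apply: level_inj => lam l01.
have := fuzzy_dist_ub u v l01; rewrite uv0 !normr_le0 !subr_eq0.
by move=> [/eqP lo /eqP hi]; rewrite !levelE// lo hi.
Qed.

Lemma fuzzy_dist_sym (R : realType) (u v : fuzzyNumber R) :
  fuzzy_dist u v = fuzzy_dist v u.
Proof.
apply/eqP; rewrite eq_le.
by apply/andP; split; apply: fuzzy_dist_le => lam l01;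
  rewrite distrC [X in _ /\ X <= _]distrC; exact: fuzzy_dist_ub.
Qed.

Lemma fuzzy_dist_triangle (R : realType) (v u w : fuzzyNumber R) :
  fuzzy_dist u w <= fuzzy_dist u v + fuzzy_dist v w.
Proof.
apply: fuzzy_dist_le => lam l01.
have [a1 a2] := fuzzy_dist_ub u v l01; have [b1 b2] := fuzzy_dist_ub v w l01.
by split; [apply: le_trans (lerD a1 b1)|apply: le_trans (lerD a2 b2)];
  exact: ler_distD.
Qed.

HB.instance Definition _ (R : realType) := gen_eqMixin (fuzzyNumber R).
HB.instance Definition _ (R : realType) := gen_choiceMixin (fuzzyNumber R).
HB.instance Definition _ (R : realType) :=
  isMetric.Build R (fuzzyNumber R) (@fuzzy_distxx R) (@fuzzy_dist_eq0 R)
    (@fuzzy_dist_sym R) (@fuzzy_dist_triangle R).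

Lemma fuzzy_mdistE (R : realType) (u v : fuzzyNumber R) :
  mdist u v = fuzzy_dist u v.
Proof. by []. Qed.

Definition similitude_on (R : realType) (A : set R) (l : R -> R) : Prop :=
  exists2 c : R, 0 <= c < 1 &
    forall x y, A x -> A y -> `|l x - l y| = c * `|x - y|.

(* Given the bijection, a left inverse of [l] on [A] is its inverse on [B]. *)
Definition homeomorphism_on (S T : topologicalType) (A : set S) (B : set T)
    (l : S -> T) : Prop :=
  [/\ {within A, continuous l}, set_bij A B l
    & exists2 g : T -> S, {within B, continuous g} & {in A, cancel l g}].

Definition fuzzy_lipschitz_on (R : realType) (A : set R)
    (q : R -> fuzzyNumber R) : Prop :=
  exists L : R, forall x y, A x -> A y ->
    fuzzy_dist (q x) (q y) <= L * `|x - y|.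

(* The maps [w i] are total but only their values on [X] are meaningful. *)
Definition invariant_compact (T : topologicalType) (n : nat) (X : set T)
    (w : 'I_n -> T -> T) (B : set T) : Prop :=
  [/\ B `<=` X, B !=set0, compact B & B = \bigcup_(i : 'I_n) (w i @` B)].

Definition is_attractor (T : topologicalType) (n : nat) (X : set T)
    (w : 'I_n -> T -> T) (B : set T) : Prop :=
  invariant_compact X w B /\
  forall B', invariant_compact X w B' -> B' = B.

(* The index [i : 'I_n] stands for the subinterval number i + 1, whose end
   points are the nodes numbered i and i + 1. *)
Definition lnode (n : nat) (i : 'I_n) : 'I_n.+1 := widen_ord (leqnSn n) i.
Definition rnode (n : nat) (i : 'I_n) : 'I_n.+1 := lift ord0 i.

Definition fif_F (R : realType) (n : nat) (l : 'I_n -> R -> R) (s : 'I_n -> R)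
    (q : 'I_n -> R -> fuzzyNumber R) (i : 'I_n) (x : R) (u : fuzzyNumber R) :
  fuzzyNumber R := fuzzy_add (fuzzy_scale (s i) u) (q i (l i x)).

Definition fif_ifs (R : realType) (n : nat) (l : 'I_n -> R -> R) (s : 'I_n -> R)
    (q : 'I_n -> R -> fuzzyNumber R) (i : 'I_n) (p : R * fuzzyNumber R) :
  R * fuzzyNumber R := (l i p.1, fif_F l s q i p.1 p.2).

Definition is_fuzzy_fif (R : realType) (n : nat) (x : 'I_n.+1 -> R)
    (u : 'I_n.+1 -> fuzzyNumber R) (l : 'I_n -> R -> R) (s : 'I_n -> R)
    (q : 'I_n -> R -> fuzzyNumber R) (f : R -> fuzzyNumber R) : Prop :=
  let I := `[x ord0, x ord_max]%classic in
  [/\ {within I, continuous f}, forall i, f (x i) = u i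
    & is_attractor (I `*` [set: fuzzyNumber R]) (fif_ifs l s q)
        [set (t, f t) | t in I]].

(* Main.v *)
Require Import Defs.
From mathcomp Require Import all_boot all_order all_algebra.
From mathcomp Require Import all_classical all_reals all_analysis.
From mathcomp Require Import ring lra.
Import Order.TTheory GRing.Theory Num.Theory.
Import numFieldNormedType.Exports.
Local Open Scope classical_set_scope.
Local Open Scope ring_scope.

(** Why [f] is Hoelder continuous.  Write [I] for the interval from the first
    node to the last and [dist] for the supremum distance of fuzzy numbers.
    That the graph of [f] equals the union of its images under the maps of the
    iterated function system says two things: every point of [I] is [l i t]
    for some cell [i] and some [t] in [I], and
    [f (l i t) = fif_F l s q i t (f t)].  As scaling by [s i] contracts
    [dist] and [q i] is Lipschitz, two points of the same cell satisfy
    [[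
      dist (f (l i t)) (f (l i t'))
        <= s i * dist (f t) (f t') + L * `|l i t - l i t'|,
    ]]
    where [`|l i t - l i t'| = c i * `|t - t'|].  A bound by
    [H * `|t - t'| `^ tau] is therefore multiplied by [s i / c i `^ tau] when
    transported into a cell, up to a term linear in the distance of the
    arguments.  There are finitely many cells, each with [s i < 1] and
    [0 < c i], so an exponent [tau] close to 0 makes all these ratios at most
    some [r < 1] ([powR_exponent_ge]), and the Hoelder estimate reproduces
    itself.

    No Hoelder constant is available to start from, only the boundedness of
    [f] on the compact interval ([within_continuous_mdist_bounded]).
    [holder_of_rescaling] starts from that bound: after [k] rescalings it
    contributes at most [r ^+ k * M], which tends to 0.

    The estimate above is silent about points of different cells, and going
    through a node between them naively would double the constant at each
    rescaling, which could destroy the contraction.  Hence two rounds in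
    [holder_of_cellwise_contraction].  The first compares an arbitrary point
    with a node: either the node is an end point of the cell of the point, so
    it is the image of a node and the pair can be rescaled, or the two are
    apart by at least the smallest gap between nodes, and boundedness is
    enough.  The second round compares arbitrary points: in the same cell they
    can be rescaled, and in different cells they are separated by a node, so
    the first round bounds them directly.  The doubling happens only once. *)

(** * The contraction estimate for the operations on fuzzy numbers *)

Lemma level_lo_add (R : realType) (u v : fuzzyNumber R) (lam : R) :
  0 <= lam <= 1 -> level_lo (fuzzy_add u v) lam = level_lo u lam + level_lo v lam.
Proof.
move=> l01; apply/eqP; rewrite eq_le; apply/andP; split.
  apply: level_lo_le => //; rewrite level_add//.
  by exists (level_lo u lam); [exact: level_lo_mem|
    exists (level_lo v lam); first exact: level_lo_mem].
have := level_lo_mem (fuzzy_add u v) l01.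
by rewrite level_add// => -[y uy [z vz <-]]; rewrite lerD ?level_lo_le.
Qed.

Lemma level_hi_add (R : realType) (u v : fuzzyNumber R) (lam : R) :
  0 <= lam <= 1 -> level_hi (fuzzy_add u v) lam = level_hi u lam + level_hi v lam.
Proof.
move=> l01; apply/eqP; rewrite eq_le; apply/andP; split.
  have := level_hi_mem (fuzzy_add u v) l01.
  by rewrite level_add// => -[y uy [z vz <-]]; rewrite lerD ?level_hi_ge.
apply: level_hi_ge => //; rewrite level_add//.
by exists (level_hi u lam); [exact: level_hi_mem|
  exists (level_hi v lam); first exact: level_hi_mem].
Qed.

Lemma level_lo_scale (R : realType) (c : R) (u : fuzzyNumber R) (lam : R) :
  0 <= c -> 0 <= lam <= 1 -> level_lo (fuzzy_scale c u) lam = c * level_lo u lam.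
Proof.
move=> c0 l01; apply/eqP; rewrite eq_le; apply/andP; split.
  apply: level_lo_le => //; rewrite level_scale//.
  by exists (level_lo u lam); first exact: level_lo_mem.
have := level_lo_mem (fuzzy_scale c u) l01.
by rewrite level_scale// => -[y uy <-]; rewrite ler_wpM2l ?level_lo_le.
Qed.

Lemma level_hi_scale (R : realType) (c : R) (u : fuzzyNumber R) (lam : R) :
  0 <= c -> 0 <= lam <= 1 -> level_hi (fuzzy_scale c u) lam = c * level_hi u lam.
Proof.
move=> c0 l01; apply/eqP; rewrite eq_le; apply/andP; split.
  have := level_hi_mem (fuzzy_scale c u) l01.
  by rewrite level_scale// => -[y uy <-]; rewrite ler_wpM2l ?level_hi_ge.
apply: level_hi_ge => //; rewrite level_scale//.
by exists (level_hi u lam); first exact: level_hi_mem.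
Qed.

Lemma fuzzy_dist_add (R : realType) (u v u' v' : fuzzyNumber R) :
  fuzzy_dist (fuzzy_add u v) (fuzzy_add u' v') <=
  fuzzy_dist u u' + fuzzy_dist v v'.
Proof.
apply: fuzzy_dist_le => lam l01; rewrite !level_lo_add ?level_hi_add//.
have [a1 a2] := fuzzy_dist_ub u u' l01; have [b1 b2] := fuzzy_dist_ub v v' l01.
by split; rewrite opprD addrACA (le_trans (ler_normD _ _))// lerD.
Qed.

Lemma fuzzy_dist_scale (R : realType) (c : R) (u v : fuzzyNumber R) :
  0 <= c ->
  fuzzy_dist (fuzzy_scale c u) (fuzzy_scale c v) <= c * fuzzy_dist u v.
Proof.
move=> c0; apply: fuzzy_dist_le => lam l01.
rewrite !level_lo_scale ?level_hi_scale// -!mulrBr !normrM (ger0_norm c0).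
by have [a1 a2] := fuzzy_dist_ub u v l01; rewrite !ler_wpM2l.
Qed.

(** * Uniform constants and the choice of the exponent *)

(** The bound [m <= 1] makes [1 - m / 2] usable as a contraction ratio. *)
Lemma finite_pos_lower_bound (R : realType) (I : finType) (F : I -> R) :
  (forall i, 0 < F i) -> exists2 m : R, 0 < m <= 1 & forall i, m <= F i.
Proof.
move=> F0; exists (\big[Num.min/1]_i F i).
  by rewrite lt_bigmin//= bigmin_le_id.
by move=> i; exact: bigmin_le.
Qed.

Lemma finite_upper_bound (R : realType) (I : finType) (F : I -> R) :
  exists2 M : R, 0 <= M & forall i, F i <= M.
Proof.
exists (\big[Num.max/0]_i F i); first exact: bigmax_ge_id.
by move=> i; exact: le_bigmax.
Qed.

(** Since [c `^ tau] tends to 1 as [tau] tends to 0, it exceeds any [rho < 1].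
    The exponent is the inverse of an integer [k] with [rho ^+ k < c]. *)
Lemma powR_exponent_ge (R : realType) (rho c : R) : 0 <= rho < 1 -> 0 < c ->
  exists2 tau : R, 0 < tau <= 1 & rho <= c `^ tau.
Proof.
move=> /andP[rho0 rho1] c0.
have : (GRing.exp rho : nat -> R) x @[x --> \oo] --> 0.
  by apply: cvg_expr; rewrite ger0_norm.
move=> /cvgrPdist_lt/(_ _ c0)[N _ /(_ N.+1)/= ].
rewrite sub0r normrN ger0_norm ?exprn_ge0// => /(_ (leqnSn N))/ltW rhoc.
exists N.+1%:R^-1; first by rewrite invr_gt0 ltr0n/= invf_le1 ?ler1n ?ltr0n.
have -> : rho = (rho ^+ N.+1) `^ N.+1%:R^-1.
  by rewrite -powR_mulrn// -powRrM mulfV ?pnatr_eq0// powRr1.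
by rewrite ge0_ler_powR ?nnegrE ?invr_ge0 ?exprn_ge0// ltW.
Qed.

(** On a bounded interval a Lipschitz term is also a Hoelder term. *)
Lemma le_mul_powR (R : realType) (D t tau : R) : 0 <= t <= D -> 0 < tau <= 1 ->
  t <= D `^ (1 - tau) * t `^ tau.
Proof.
move=> /andP[t0 tD] /andP[tau0 tau1].
have {1}-> : t = t `^ (1 - tau) * t `^ tau.
  by rewrite -powRD ?subrK ?powRr1// oner_eq0.
rewrite ler_wpM2r ?powR_ge0// ge0_ler_powR ?nnegrE ?subr_ge0//.
exact: le_trans tD.
Qed.

(** * Boundedness, and its improvement by rescaling *)

(** Continuity of [mdist (f a)] reduces the claim to the boundedness of compact
    sets of reals. *)
Lemma within_continuous_mdist_bounded (R : realType) (S : topologicalType)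
    (T : metricType R) (A : set S) (f : S -> T) (a : S) :
  compact A -> {within A, continuous f} ->
  exists2 M : R, 0 <= M & forall y y', A y -> A y' -> mdist (f y) (f y') <= M.
Proof.
move=> cA cf.
have cg : {within A, continuous (mdist (f a) \o f)}.
  apply: within_continuous_comp cf => p _.
  apply/cvgrPdist_lt => e e0.
  near=> q.
  have pq : mdist p q < e.
    near: q; apply: (@metricType_numDomainType.cvgr_dist_lt _ _ _ _ _ id) => //.
  have h1 := metric_triangle (f a) p q; have h2 := metric_triangle (f a) q p.
  rewrite (metric_sym q p) in h2.
  by rewrite ltr_norml; apply/andP; split; lra.
have [N [_ /(_ _ (ltr_pwDr ltr01 (lexx N))) hN]] :=
  compact_bounded (continuous_compact cg cA).
have g_le y : A y -> mdist (f a) (f y) <= N + 1.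
  move=> Ay; apply: (le_trans (ler_norm _)); apply: hN.
  by exists y.
exists (Num.max 0 (N + 1 + (N + 1))); first by rewrite le_max lexx.
move=> y y' /g_le y1 /g_le y2; rewrite le_max; apply/orP; right.
apply: (le_trans (metric_triangle _ (f a) _)).
by rewrite lerD// metric_sym.
Unshelve. all: by end_near.
Qed.

(** Unfolding the alternative [k] times shows
    [d y y' <= H * `|y - y'| `^ tau + r ^+ k * M], where [H = K / (1 - r)] is
    the fixed point of [fun H => r * H + K].  The remainder vanishes as [k]
    grows.  The relation [P] selects the pairs that the rescaling preserves; it
    is left free because the lemma is needed both for pairs made of a point and
    a node and for arbitrary pairs. *)
Lemma holder_of_rescaling (R : realType) (P : R -> R -> Prop)
    (d : R -> R -> R) (M K r tau : R) :
  0 <= r < 1 -> 0 < tau -> 0 <= M -> 0 <= K ->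
  (forall y y', P y y' -> d y y' <= M) ->
  (forall y y', P y y' ->
    d y y' <= K * `|y - y'| `^ tau \/
    exists z z' s c, [/\ P z z', 0 <= s <= r * c `^ tau, 0 <= c <= 1,
      `|y - y'| = c * `|z - z'| &
      d y y' <= s * d z z' + K * `|y - y'| `^ tau]) ->
  forall y y', P y y' -> d y y' <= K / (1 - r) * `|y - y'| `^ tau.
Proof.
move=> /andP[r0 r1] tau0 M0 K0 dM step.
have r10 : 0 < 1 - r by rewrite subr_gt0.
set H := K / (1 - r).
have H0 : 0 <= H by rewrite divr_ge0// ltW.
have KH : r * H + K = H by rewrite /H; field; rewrite gt_eqF.
have approx k : forall y y', P y y' -> d y y' <= H * `|y - y'| `^ tau + r ^+ k * M.
  elim: k => [|k IHk] y y' Pyy'.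
    rewrite expr0 mul1r (le_trans (dM _ _ Pyy'))// lerDr.
    by rewrite mulr_ge0 ?powR_ge0.
  have t0 := powR_ge0 `|y - y'| tau.
  have rM0 : 0 <= r ^+ k * M by rewrite mulr_ge0 ?exprn_ge0.
  case: (step _ _ Pyy') => [yK|].
    rewrite (le_trans yK)// exprS -mulrA ler_wpDr ?(mulr_ge0 r0)//.
    by rewrite ler_wpM2r// -KH lerDr mulr_ge0.
  move=> [z [z' [s [c [Pzz' /andP[s0 sr] /andP[c0 c1] yz dyy']]]]].
  have ct1 : c `^ tau <= 1.
    have /(_ c 1) := ge0_ler_powR (ltW tau0).
    by rewrite !nnegrE powR1 => -> //.
  (* As [c <= 1], the ratio [s] is itself at most [r]. *)
  have sr' : s <= r by apply: (le_trans sr); rewrite ler_piMr.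
  apply: (le_trans dyy').
  have e1 : s * d z z' <= s * (H * `|z - z'| `^ tau + r ^+ k * M).
    by rewrite ler_wpM2l// IHk.
  have e2 : s * (r ^+ k * M) <= r * (r ^+ k * M) by rewrite ler_wpM2r.
  have e3 : s * (H * `|z - z'| `^ tau) <= r * H * `|y - y'| `^ tau.
    rewrite yz powRM// (_ : r * H * _ = r * c `^ tau * (H * `|z - z'| `^ tau)).
      by rewrite ler_wpM2r// mulr_ge0 ?powR_ge0.
    by ring.
  by rewrite exprS -mulrA -[in leRHS]KH; lra.
move=> y y' Pyy'.
have cv : H * `|y - y'| `^ tau + r ^+ k * M @[k --> \oo] --> H * `|y - y'| `^ tau.
  rewrite -[X in _ --> X]addr0 -[X in _ --> _ + X](mul0r M).
  apply: cvgD; first exact: cvg_cst.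
  by apply: cvgMl; apply: cvg_expr; rewrite ger0_norm.
by apply: (cvgr_to_ge cv); near=> k; exact: approx.
Unshelve. all: by end_near.
Qed.

(** * Functions that are contracted from cell to cell *)

Lemma pairwise_gap (R : realType) (n : nat) (x : 'I_n.+1 -> R) :
  (forall i j : 'I_n.+1, (i < j)%N -> x i < x j) ->
  exists2 delta : R, 0 < delta &
    forall i j : 'I_n.+1, (i < j)%N -> delta <= x j - x i.
Proof.
move=> x_lt.
have [|delta /andP[delta0 _] hdelta] := @finite_pos_lower_bound R
    ('I_n.+1 * 'I_n.+1)%type (fun p => if (p.1 < p.2)%N then x p.2 - x p.1 else 1).
  by move=> [i j] /=; case: ifPn => // ij; rewrite subr_gt0 x_lt.
by exists delta => // i j ij; have := hdelta (i, j); rewrite /= ij.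
Qed.

(** The values of [f] may lie in any metric space: only the contraction from
    each cell and the boundedness of [f] matter.  The two rounds are
    [node_holder] and the final application of [holder_of_rescaling]. *)
Lemma holder_of_cellwise_contraction (R : realType) (n : nat)
    (x : 'I_n.+1 -> R) (T : metricType R) (f : R -> T)
    (l : 'I_n -> R -> R) (s : 'I_n -> R) (L M : R) :
  let I := `[x ord0, x ord_max]%classic in
  (forall i j : 'I_n.+1, (i < j)%N -> x i < x j) ->
  (forall i t, I t -> x (lnode i) <= l i t <= x (rnode i)) ->
  (forall y, I y -> exists i, exists2 t, I t & y = l i t) ->
  (forall i, l i (x ord0) = x (lnode i)) ->
  (forall i, l i (x ord_max) = x (rnode i)) ->
  (forall i, similitude_on I (l i)) ->
  (forall i, 0 <= s i < 1) ->
  0 <= L -> 0 <= M ->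
  (forall y y', I y -> I y' -> mdist (f y) (f y') <= M) ->
  (forall i t t', I t -> I t' ->
    mdist (f (l i t)) (f (l i t')) <=
    s i * mdist (f t) (f t') + L * `|l i t - l i t'|) ->
  exists H tau : R, 0 < tau <= 1 /\
    forall y y', I y -> I y' -> mdist (f y) (f y') <= H * `|y - y'| `^ tau.
Proof.
move=> I x_lt l_cell l_cover l_left l_right l_sim s_itv L0 M0 fM f_step.
have x_le (i j : 'I_n.+1) : (i <= j)%N -> x i <= x j.
  rewrite leq_eqVlt => /predU1P[/val_inj->//|/x_lt]; exact: ltW.
have Ix k : I (x k) by rewrite /I/= in_itv/= !x_le// -ltnS.
have [c c_sim] : {c : 'I_n -> R & forall i, 0 <= c i < 1 /\
    forall y y', I y -> I y' -> `|l i y - l i y'| = c i * `|y - y'|}.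
  apply: (@choice _ _ (fun i a => 0 <= a < 1 /\ forall y y', I y -> I y' ->
    `|l i y - l i y'| = a * `|y - y'|)) => i.
  by have [c c01 ci] := l_sim i; exists c.
(* [l i] separates the two ends of [I], so its ratio cannot vanish. *)
have c_gt0 i : 0 < c i.
  have [/andP[ci0 _] ci] := c_sim i.
  have := ci _ _ (Ix ord_max) (Ix ord0); rewrite l_left l_right => e.
  rewrite lt0r ci0 andbT; apply/eqP => ci_eq0.
  move: e; rewrite ci_eq0 mul0r => /eqP; rewrite normr_eq0 subr_eq0 => /eqP e.
  by have := @x_lt (lnode i) (rnode i) (ltnSn _); rewrite e ltxx.
have [c0 /andP[c0_gt0 _] c0_le] := finite_pos_lower_bound R _ c c_gt0.
have [|m /andP[m0 m1] m_le] := finite_pos_lower_bound R _ (fun i => 1 - s i).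
  by move=> i; have /andP[_] := s_itv i; rewrite subr_gt0.
(* Every [s i] is at most [1 - m <= r * r]: one factor [r] is the contraction
   ratio, the other is absorbed by [r <= c i `^ tau]. *)
pose r := 1 - m / 2.
have r01 : 0 <= r < 1 by apply/andP; split; rewrite /r; lra.
have [r0 r1] := andP r01.
have [tau tau01 r_le] := powR_exponent_ge R r c0 r01 c0_gt0.
have [tau0 tau1] := andP tau01.
have s_le i : 0 <= s i <= r * c i `^ tau.
  have /andP[-> _] /= := s_itv i.
  apply: (@le_trans _ _ (r * r)).
    by have := m_le i; rewrite /r; nra.
  rewrite ler_wpM2l// (le_trans r_le)// ge0_ler_powR ?nnegrE//.
  - exact: ltW.
  - exact: ltW.
  - exact: ltW.
have [delta delta0 gap] := pairwise_gap R n x x_lt.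
pose W := (x ord_max - x ord0) `^ (1 - tau).
have lin y y' : I y -> I y' -> `|y - y'| <= W * `|y - y'| `^ tau.
  rewrite /I/= !in_itv/= => /andP[? ?] /andP[? ?].
  by apply: le_mul_powR => //; rewrite normr_ge0 ler_norml; apply/andP; split; lra.
have W0 : 0 <= W := powR_ge0 _ _.
have l_in i t : I t -> I (l i t).
  move=> /(l_cell i)/andP[lo hi]; rewrite /I/= in_itv/=.
  have := Ix (lnode i); have := Ix (rnode i).
  by rewrite /I/= !in_itv/= => /andP[_ b] /andP[a _]; rewrite (le_trans a)// (le_trans _ b).
have rescale (P : R -> R -> Prop) K i t t' : I t -> I t' -> P t t' ->
    L * W <= K -> exists z z' s' c', [/\ P z z', 0 <= s' <= r * c' `^ tau,
      0 <= c' <= 1, `|l i t - l i t'| = c' * `|z - z'| &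
      mdist (f (l i t)) (f (l i t')) <=
        s' * mdist (f z) (f z') + K * `|l i t - l i t'| `^ tau].
  move=> It It' Ptt' LWK; exists t, t', (s i), (c i).
  have [/andP[ci0 ci1] ci] := c_sim i.
  split=> //; first by rewrite ci0 ltW.
    exact: ci.
  apply: (le_trans (f_step _ _ _ It It')); rewrite lerD2l.
  apply: (@le_trans _ _ (L * (W * `|l i t - l i t'| `^ tau))).
    by rewrite ler_wpM2l// lin//; exact: l_in.
  by rewrite mulrA ler_wpM2r ?powR_ge0.
pose K1 := L * W + M / delta `^ tau.
have dt0 : 0 < delta `^ tau by exact: powR_gt0.
have LW0 : 0 <= L * W by rewrite mulr_ge0.
have Md0 : 0 <= M / delta `^ tau by rewrite divr_ge0// ltW.
have K10 : 0 <= K1 by rewrite addr_ge0.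
(* At distance at least [delta], boundedness is a Hoelder bound. *)
have far y y' : I y -> I y' -> delta <= `|y - y'| ->
    mdist (f y) (f y') <= K1 * `|y - y'| `^ tau.
  move=> Iy Iy' dyy'; apply: (le_trans (fM _ _ Iy Iy')).
  apply: (@le_trans _ _ (M / delta `^ tau * `|y - y'| `^ tau)); last first.
    by rewrite ler_wpM2r ?powR_ge0// lerDr.
  rewrite mulrAC ler_pdivlMr// ler_wpM2l// ge0_ler_powR ?nnegrE// ltW//.
have node_holder y k : I y ->
    mdist (f y) (f (x k)) <= K1 / (1 - r) * `|y - x k| `^ tau.
  move=> Iy.
  apply: (holder_of_rescaling R (fun y y' => I y /\ exists k, y' = x k)
    (fun y y' => mdist (f y) (f y')) M K1 r tau) => //; last by split; [|exists k].
  - by move=> {Iy k}y _ [Iy [k ->]]; exact: fM.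
  - move=> {Iy k}y _ [Iy [k ->]].
    have [i [t It yE]] := l_cover y Iy; rewrite yE.
    have LWK : L * W <= K1 by rewrite lerDl.
    have /andP[lo hi] := l_cell i t It.
    (* If [x k] is an end of the cell of [y], it is the image of an end of [I]
       under [l i], so the rescaled pair is again made of a point and a node. *)
    have [ki|ik|ki] := ltngtP k (lnode i).
    + left; apply: far => //; first exact: l_in.
      rewrite ger0_norm; first by have := gap _ _ ki; lra.
      by have := x_lt _ _ ki; lra.
    (* [k] comes after the left end of cell [i], hence not before its right
       end, which has the next index. *)
    + have [ki|ki|ki] := ltngtP (rnode i) k.
      * left; apply: far => //; first exact: l_in.
        rewrite ler0_norm; first by have := gap _ _ ki; lra.
        by have := x_lt _ _ ki; lra.
      * by move: (leq_trans ki ik); rewrite ltnn.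
      * right; rewrite -(val_inj ki) -l_right; apply: rescale => //.
        by split => //; exists ord_max.
    + right; rewrite (val_inj ki) -l_left; apply: rescale => //.
      by split => //; exists ord0.
pose H1 := K1 / (1 - r).
have H10 : 0 <= H1 by rewrite divr_ge0// subr_ge0 ltW.
(* Monotonicity of the power keeps both halves below the whole. *)
have through_node y y' k : I y -> I y' -> y <= x k <= y' ->
    mdist (f y) (f y') <= (H1 + H1) * `|y - y'| `^ tau.
  move=> Iy Iy' /andP[yx xy'].
  apply: (le_trans (metric_triangle _ (f (x k)) _)).
  rewrite mulrDl; apply: lerD.
    apply: (le_trans (node_holder y k Iy)); rewrite ler_wpM2l//.
    rewrite ge0_ler_powR ?nnegrE// ?(ltW tau0)//.
    rewrite !ler0_norm; lra.
  rewrite metric_sym; apply: (le_trans (node_holder y' k Iy')).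
  rewrite ler_wpM2l// ge0_ler_powR ?nnegrE// ?(ltW tau0)//.
  rewrite ger0_norm ?ler0_norm; lra.
pose K2 := L * W + (H1 + H1).
have K20 : 0 <= K2 by rewrite !addr_ge0.
exists (K2 / (1 - r)), tau; split=> // y y' Iy Iy'.
apply: (holder_of_rescaling R (fun y y' => I y /\ I y')
  (fun y y' => mdist (f y) (f y')) M K2 r tau) => //.
  by move=> z z' [Iz Iz']; exact: fM.
move=> {y y' Iy Iy'} y y' [Iy Iy'].
have cross (i j : 'I_n) t t' : (i < j)%N -> I t -> I t' ->
    mdist (f (l i t)) (f (l j t')) <= K2 * `|l i t - l j t'| `^ tau.
  move=> ij It It'.
  have /andP[_ lo] := l_cell i t It; have /andP[hi _] := l_cell j t' It'.
  apply: (@le_trans _ _ ((H1 + H1) * `|l i t - l j t'| `^ tau)); last first.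
    by rewrite ler_wpM2r ?powR_ge0// lerDr.
  apply: (through_node _ _ (rnode i)); [exact: l_in|exact: l_in|].
  by rewrite lo (le_trans _ hi)// x_le.
have [i [t It yE]] := l_cover y Iy; have [j [t' It' y'E]] := l_cover y' Iy'.
rewrite {}yE {}y'E; have [ij|ji|ij] := ltngtP i j.
- by left; exact: cross.
- by left; rewrite metric_sym distrC; exact: cross.
- right; rewrite (val_inj ij); apply: rescale => //.
  by rewrite lerDl addr_ge0.
Qed.

Theorem theorem6 (R : realType) (n : nat) (n_gt0 : (0 < n)%N)
    (x : 'I_n.+1 -> R) (u : 'I_n.+1 -> fuzzyNumber R)
    (x_lt : forall i j : 'I_n.+1, (i < j)%N -> x i < x j)
    (l : 'I_n -> R -> R) (s : 'I_n -> R) (q : 'I_n -> R -> fuzzyNumber R)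
    (l_homeo : forall i : 'I_n,
      homeomorphism_on `[x ord0, x ord_max] `[x (lnode i), x (rnode i)] (l i))
    (l_left : forall i : 'I_n, l i (x ord0) = x (lnode i))
    (l_right : forall i : 'I_n, l i (x ord_max) = x (rnode i))
    (l_sim : forall i : 'I_n, similitude_on `[x ord0, x ord_max] (l i))
    (s_itv : forall i : 'I_n, 0 <= s i < 1)
    (q_lip : forall i : 'I_n,
      fuzzy_lipschitz_on `[x (lnode i), x (rnode i)] (q i))
    (F_left : forall i : 'I_n, fif_F l s q i (x ord0) (u ord0) = u (lnode i))
    (F_right : forall i : 'I_n,
      fif_F l s q i (x ord_max) (u ord_max) = u (rnode i))
    (f : R -> fuzzyNumber R) (f_fif : is_fuzzy_fif x u l s q f) :
  exists H tau : R, 0 < tau <= 1 /\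
    forall y y' : R, y \in `[x ord0, x ord_max] -> y' \in `[x ord0, x ord_max] ->
      fuzzy_dist (f y) (f y') <= H * `|y - y'| `^ tau.
Proof.
have [f_cont _ [[_ _ _ f_inv] _]] := f_fif.
set I := `[x ord0, x ord_max]%classic in f_cont f_inv.
have l_cell i t : I t -> x (lnode i) <= l i t <= x (rnode i).
  have [_ [l_fun _ _] _] := l_homeo i.
  by move=> /l_fun; rewrite /= in_itv.
have l_cover y : I y -> exists i, exists2 t, I t & y = l i t.
  move=> Iy; have : [set (t, f t) | t in I] (y, f y) by exists y.
  by rewrite f_inv => -[i _ [_ [t It <-] [<- _]]]; exists i, t.
have f_eq i t : I t -> f (l i t) = fif_F l s q i t (f t).
  move=> It; have : [set (t, f t) | t in I] (l i t, fif_F l s q i t (f t)).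
    by rewrite f_inv; exists i => //; exists (t, f t) => //; exists t.
  by move=> [t' _ [-> ->]].
have [Lq q_Lq] := choice q_lip.
have [L L0 LqL] := finite_upper_bound R _ Lq.
have [M M0 fM] := within_continuous_mdist_bounded R _ _ _ _ (x ord0)
  (@segment_compact _ _ _) f_cont.
have [|H [tau [tau01 holder]]] := holder_of_cellwise_contraction R n x _ f l s
    L M x_lt l_cell l_cover l_left l_right l_sim s_itv L0 M0 fM.
  move=> i t t' It It'; rewrite !f_eq// !fuzzy_mdistE.
  apply: (le_trans (fuzzy_dist_add _ _ _ _ _)); apply: lerD.
    by apply: fuzzy_dist_scale; case/andP: (s_itv i).
  apply: (@le_trans _ _ (Lq i * `|l i t - l i t'|)).
    by apply: q_Lq; rewrite /= in_itv/=; exact: l_cell.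
  by rewrite ler_wpM2r.
by exists H, tau; split.
Qed.
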